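(* Fix an o-minimal structure. Let $D \colon \mathbb{R}^p \rightrightarrows \mathbb{R}^p$ be a conservative field for $f\colon\mathbb{R}^p\to\mathbb{R}$, and assume $f$ and $D$ are definable. Then the set of $D$-critical values $\{f(x) : x \in \mathbb{R}^p,\ 0 \in D(x)\}$ is finite.
   Context: A set valued map $D\colon\mathbb{R}^p\rightrightarrows\mathbb{R}^p$ is a conservative field if its graph is closed, its values are nonempty and compact, and for every absolutely continuous loop $\gamma\colon[0,1]\to\mathbb{R}^p$, $\int_0^1 \max_{v\in D(\gamma(t))}\langle\dot\gamma(t),v\rangle\,dt=0$; $D$ is a conservative field for $f$ if moreover $f(x)=f(0)+\int_0^1\max_{v\in D(\gamma(t))}\langle\dot\gamma(t),v\rangle\,dt$ for every absolutely continuous $\gamma$ from $0$ to $x$. Definable means belonging (via graph, for maps) to a fixed o-minimal structure on $(\mathbb{R},+,\cdot)$, e.g. the semialgebraic sets: a family of Boolean algebras of subsets of $\mathbb{R}^p$ containing algebraic sets, stable under products with $\mathbb{R}$ and coordinate projections, whose subsets of $\mathbb{R}$ are exactly finite unions of intervals and points. *)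

(* Defs.v *)
From HB Require Import structures.
From mathcomp Require Import all_boot all_order all_algebra.
From mathcomp Require Import all_classical all_reals all_analysis.
From mathcomp Require mpoly.
Set Implicit Arguments. Unset Strict Implicit. Unset Printing Implicit Defensive.
Import Order.TTheory GRing.Theory Num.Theory.
Import numFieldNormedType.Exports.
Local Open Scope classical_set_scope.
Local Open Scope ring_scope.

Section Defs.
Variable R : realType.

Definition algebraic_set (n : nat) (P : mpoly.mpoly n R) : set 'rV[R]_n :=
  [set x | mpoly.meval (fun i => x ord0 i) P = 0].

Definition o_minimal (S : forall n : nat, set (set 'rV[R]_n)) : Prop :=
  (forall n, S n set0) /\
  (forall n A, S n A -> S n (~` A)) /\
  (forall n A B, S n A -> S n B -> S n (A `|` B)) /\
  (forall n (P : mpoly.mpoly n R), S n (algebraic_set P)) /\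
  (forall n (A : set 'rV[R]_n), S n A ->
      S (n + 1)%N [set z | A (lsubmx z)] /\ S (1 + n)%N [set z | A (rsubmx z)]) /\
  (forall n (A : set 'rV[R]_(n + 1)), S (n + 1)%N A ->
      S n (@lsubmx R 1 n 1 @` A)) /\
  (* definable subsets of R are exactly the finite unions of intervals and
     points (points being degenerate closed intervals [a, a]) *)
  (forall A : set 'rV[R]_1, S 1%N A <->
      exists s : seq (interval R),
        A = [set x | exists2 I, I \in s & x ord0 ord0 \in I]).

Definition definable_fun (S : forall n : nat, set (set 'rV[R]_n)) (p : nat)
    (f : 'rV[R]_p -> R) : Prop :=
  S (p + 1)%N [set z | f (lsubmx z) = rsubmx z ord0 ord0].

Definition definable_setmap (S : forall n : nat, set (set 'rV[R]_n)) (p : nat)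
    (D : 'rV[R]_p -> set 'rV[R]_p) : Prop :=
  S (p + p)%N [set z | D (lsubmx z) (rsubmx z)].

Definition dotp (p : nat) (u v : 'rV[R]_p) : R := \sum_i u ord0 i * v ord0 i.

Definition abs_continuous01 (p : nat) (g : R -> 'rV[R]_p) : Prop :=
  forall e : R, 0 < e -> exists2 d : R, 0 < d &
    forall (k : nat) (a b : 'I_k -> R),
      (forall i, 0 <= a i /\ a i <= b i /\ b i <= 1) ->
      (forall i j, i != j -> b i <= a j \/ b j <= a i) ->
      \sum_i (b i - a i) < d ->
      \sum_i `|g (b i) - g (a i)| < e.

Definition support_integrand (p : nat) (D : 'rV[R]_p -> set 'rV[R]_p)
    (g : R -> 'rV[R]_p) (t : R) : \bar R :=
  ereal_sup [set (dotp (derive1 g t) v)%:E | v in D (g t)].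

Definition path_integral (p : nat) (D : 'rV[R]_p -> set 'rV[R]_p)
    (g : R -> 'rV[R]_p) : \bar R :=
  (\int[lebesgue_measure]_(t in `[(0:R)%R, (1:R)%R]) support_integrand D g t)%E.

Definition conservative_field (p : nat) (D : 'rV[R]_p -> set 'rV[R]_p) : Prop :=
  [/\ closed [set xv : 'rV[R]_p * 'rV[R]_p | D xv.1 xv.2],
      (forall x, D x !=set0 /\ compact (D x)) &
      (forall g : R -> 'rV[R]_p, abs_continuous01 g -> g 0 = g 1 ->
          path_integral D g = 0%E)].

Definition conservative_field_for (p : nat) (D : 'rV[R]_p -> set 'rV[R]_p)
    (f : 'rV[R]_p -> R) : Prop :=
  conservative_field D /\
  forall (x : 'rV[R]_p) (g : R -> 'rV[R]_p),
    abs_continuous01 g -> g 0 = 0 -> g 1 = x ->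
    (f x)%:E = ((f 0)%:E + path_integral D g)%E.

End Defs.

(* Main.v *)
(* The set of critical values is definable; if it were infinite, it would contain
   an interval, and definable choice would give over a smaller interval a curve
   [x(t)] of critical points with [f(x(t)) = t]. After further shrinking, every
   coordinate of [x] is monotone. Let [l(t)] be the sum of [t] and of all the
   coordinates, each with the sign that makes it nondecreasing: the increments of
   [l] bound those of [t] and of every coordinate. The image of [l] is definable
   and infinite, so it contains an interval, on which the inverse of [l]
   reparametrizes [x] as a Lipschitz curve; no continuity of [x] is needed.
   Along an absolutely continuous curve of critical points [f] is constant, since
   the integrand of the path integral is nonnegative for the curve and for its
   reverse. This contradicts [f(x(t)) = t].

   Each shrinking uses that, when countably many definable sets cover an interval,
   one of them is uncountable and hence contains an interval. For definable choice
   these are the sets of [t] whose fiber contains a given rational and the set of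
   [t] whose fiber has a least element; for monotonicity, the sets of [t] at which
   a one-sided comparison holds up to distance 1/(n+1). *)
Require Import Defs.
From HB Require Import structures.
From mathcomp Require Import all_boot all_order all_algebra.
From mathcomp Require Import all_classical all_reals all_analysis.
From mathcomp Require Import lra.
From mathcomp Require Import(canonicals) mpoly.
Import Order.TTheory GRing.Theory Num.Theory.
Import numFieldNormedType.Exports.
Local Open Scope classical_set_scope.
Local Open Scope ring_scope.
Set Implicit Arguments. Unset Strict Implicit. Unset Printing Implicit Defensive.

(** * Finite unions of intervals *)

Section finite_itv_unions.
Variable R : realType.
Implicit Types (A : set R) (I J : interval R) (x y z r : R).

Definition proper_itv I : Prop := exists x y, [/\ x \in I, y \in I & x < y].

Definition proper_subitv J I : Prop := {subset J <= I} /\ proper_itv J.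

Lemma proper_subitv_trans I J K :
  proper_subitv J I -> proper_subitv K J -> proper_subitv K I.
Proof. by move=> [JI _] [KJ pK]; split=> // x /KJ/JI. Qed.

Lemma proper_itv_uncountable I : proper_itv I -> ~ countable [set` I].
Proof.
move=> [x [y [xI yI xy]]] countI.
have : countable [set` `[x, y]].
  apply: sub_countable countI; apply: subset_card_le => z.
  by rewrite /= in_itv; exact: (@interval_is_interval _ I).
move/countable_lebesgue_measure0; rewrite lebesgue_measure_itv /= lte_fin xy.
by move/eqP; rewrite -EFinB eqe subr_eq0 gt_eqF.
Qed.

Lemma proper_subitv_short I r : proper_itv I -> 0 < r ->
  exists2 J, proper_subitv J I & {in J &, forall x y, y < x + r}.
Proof.
move=> [x [y [xI yI xy]]] r0; pose m := Num.min y (x + r / 2).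
have xm : x < m by rewrite lt_min xy ltrDl divr_gt0.
exists `[x, m]; first split.
- move=> z; rewrite in_itv /= le_min => /and3P[xz zy _].
  by apply: (@interval_is_interval _ I _ _ xI yI); rewrite xz.
- by exists x, m; rewrite !in_itv /= !lexx (ltW xm).
- move=> z t; rewrite !in_itv /= !le_min => /and3P[xz _ _] /and3P[_ _ tx].
  by lra.
Qed.

Lemma infinite_itv_proper I : infinite_set [set` I] -> proper_itv I.
Proof.
move=> infI; have [x xI] := infinite_setN0 infI.
have [y [yI /eqP]] := infinite_setN0 (infinite_setD infI (finite_set1 x)).
by rewrite neq_lt => /orP[xy|xy]; [exists y, x|exists x, y].
Qed.

Definition finite_itv_union A : Prop :=
  exists s : seq (interval R), A = [set x | exists2 I, I \in s & x \in I].

Lemma finite_itv_union_interior A : finite_itv_union A -> infinite_set A ->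
  exists2 J, proper_itv J & [set` J] `<=` A.
Proof.
move=> [s ->] infA; apply: contrapT => noJ; apply: infA.
suff : finite_set (\bigcup_(I in [set` s]) [set` I]).
  by apply: sub_finite_set => x [I Is xI]; exists I.
apply: bigcup_finite => // I Is; apply: contrapT => /infinite_itv_proper properI.
by apply: noJ; exists I => // x xI; exists I.
Qed.

Lemma finite_itv_unionIitv A I :
  finite_itv_union A -> finite_itv_union (A `&` [set` I]).
Proof.
move=> [s ->]; exists [seq (J `&` I)%O | J <- s]; apply/seteqP; split=> x /=.
  by case=> -[J Js xJ] xI; exists (J `&` I)%O; [exact: map_f|rewrite in_itvI xJ].
by case=> _ /mapP[J Js ->]; rewrite in_itvI => /andP[xJ xI]; split=> //; exists J.
Qed.

Lemma countable_cover_interior (T : countType) (X : T -> set R) I :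
  proper_itv I -> (forall i, finite_itv_union (X i)) ->
  (forall t, t \in I -> exists i, X i t) ->
  exists2 J, proper_subitv J I & exists i, [set` J] `<=` X i.
Proof.
move=> properI uX cover; apply: contrapT => noJ.
apply: (proper_itv_uncountable properI).
apply: (@sub_countable _ _ _ (\bigcup_i (X i `&` [set` I]))).
  by apply: subset_card_le => t tI; have [i Xit] := cover t tI; exists i.
apply: bigcup_countable => // i _; apply: finite_set_countable.
apply: contrapT => /(finite_itv_union_interior (finite_itv_unionIitv I (uX i))).
move=> [J properJ JXI]; apply: noJ; exists J; first by split=> // t /JXI[].
by exists i => t /JXI[].
Qed.

Lemma itv_right_germ I x :
  (\forall y \near x^'+, y \in I) \/ (\forall y \near x^'+, y \notin I).
Proof.
have [|] := pselect (exists2 y, x < y & forall z, x < z <= y -> z \notin I).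
  move=> [y xy yI]; right; near=> z; apply: yI; apply/andP; split; near: z.
    exact: nbhs_right_gt.
  exact: nbhs_right_le.
move=> frequent; have {}frequent y : x < y -> exists2 z, x < z <= y & z \in I.
  move=> xy; apply: contrapT => noz; apply: frequent; exists y => // z xzy.
  by apply/negP => zI; apply: noz; exists z.
have [y /andP[xy _] yI] : exists2 y, x < y <= x + 1 & y \in I.
  by apply: frequent; rewrite ltrDl.
left; near=> z; have xz : x < z by near: z; exact: nbhs_right_gt.
have [w /andP[_ wz] wI] := frequent z xz.
apply: (@interval_is_interval _ I _ _ wI yI); rewrite wz.
by near: z; exact: nbhs_right_le.
Unshelve. all: by end_near. Qed.

Lemma finite_itv_union_right_germ A x : finite_itv_union A ->
  (\forall y \near x^'+, A y) \/ (\forall y \near x^'+, ~ A y).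
Proof.
move=> [s ->]; elim: s => [|I s IHs]; first by right; near=> y => -[].
have [IIx|NIx] := itv_right_germ I x.
  by left; apply: filterS IIx => y yI; exists I; rewrite ?mem_head.
case: IHs => [sx|Nsx]; [left|right].
  by apply: filterS sx => y [J Js yJ]; exists J; rewrite // inE Js orbT.
apply: filterS2 NIx Nsx => y yNI yNs [J]; rewrite inE => /orP[/eqP->|Js] yJ.
  by rewrite yJ in yNI.
by apply: yNs; exists J.
Unshelve. all: by end_near. Qed.

Lemma at_right_natSinv (P : set R) x : (\forall y \near x^'+, P y) ->
  exists n, forall y, x < y -> y < x + n.+1%:R^-1 -> P y.
Proof.
move=> [e /= e0 eP].
have [n _ /(_ n (leqnn n)) /= ne] := near_infty_natSinv_lt (PosNum e0).
exists n => y xy yn; apply: eP => //=.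
by rewrite distrC gtr0_norm ?subr_gt0 // ltrBlDl (lt_trans yn) // ltrD2l.
Qed.

Lemma finite_set_min A :
  finite_set A -> A !=set0 -> exists2 y, A y & lbound A y.
Proof.
move=> /finite_seqP[s ->] [y0 ys].
have [//|y _ ymin] := @arg_minP _ _ _ (SeqSub ys) xpredT val.
by exists (val y); [exact: valP|move=> z zs; exact: (ymin (SeqSub zs))].
Qed.

Lemma finite_itv_union_rat_or_min A : finite_itv_union A -> A !=set0 ->
  (exists q : rat, A (ratr q)) \/ exists2 y, A y & lbound A y.
Proof.
move=> uA A0; have [fA|] := pselect (finite_set A).
  by right; exact: finite_set_min.
move=> /(finite_itv_union_interior uA)[J [x [y [xJ yJ xy]]] JA]; left.
have [q] := rat_in_itvoo xy; rewrite in_itv /= => /andP[xq qy]; exists q.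
by apply: JA; apply: (@interval_is_interval _ J _ _ xJ yJ); rewrite !ltW.
Qed.

End finite_itv_unions.

(** * Definable predicates *)

Section definability.
Variables (R : realType) (S : forall n : nat, set (set 'rV[R]_n)).
Hypothesis omS : o_minimal S.
Local Notation env := (nat -> R).
Implicit Types (P Q : env -> Prop) (e : env) (t u : env -> R).

Definition env_of_row n (v : 'rV[R]_n) : env :=
  fun i => oapp (fun j : 'I_n => v ord0 j) 0 (insub i).

Lemma env_of_row_ord n (v : 'rV[R]_n) (j : 'I_n) : env_of_row v j = v ord0 j.
Proof. by rewrite /env_of_row valK. Qed.

Lemma row_env_of_row n (v : 'rV[R]_n) : \row_j env_of_row v j = v.
Proof. by apply/rowP => j; rewrite mxE env_of_row_ord. Qed.

Lemma env_of_lsubmx n m (v : 'rV[R]_(n + m)) i : (i < n)%N ->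
  env_of_row (lsubmx v) i = env_of_row v i.
Proof.
move=> lt_in; rewrite -[i]/(val (Ordinal lt_in)).
by rewrite env_of_row_ord mxE -env_of_row_ord.
Qed.

Lemma env_of_rsubmx n m (v : 'rV[R]_(n + m)) i : (i < m)%N ->
  env_of_row (rsubmx v) i = env_of_row v (n + i)%N.
Proof.
move=> lt_im; rewrite -[i]/(val (Ordinal lt_im)).
by rewrite env_of_row_ord mxE -env_of_row_ord.
Qed.

Definition agree n e e' : Prop := forall i, (i < n)%N -> e i = e' i.

Lemma agree_sym n e e' : agree n e e' -> agree n e' e.
Proof. by move=> ee' i /ee'. Qed.

Lemma agree_leq n m e e' : (n <= m)%N -> agree m e e' -> agree n e e'.
Proof. by move=> nm ee' i lt_in; apply: ee'; exact: leq_trans nm. Qed.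

Definition scons T (y : T) (z : nat -> T) : nat -> T :=
  fun i => if i is j.+1 then z j else y.

Lemma agree_scons n y e e' : agree n e e' -> agree n.+1 (scons y e) (scons y e').
Proof. by move=> ee' [|i] //; exact: ee'. Qed.

Definition depends_on n P : Prop := forall e e', agree n e e' -> P e -> P e'.

(* Predicates live on environments [nat -> R], of which only finitely many
   entries matter, so that changing the dimension needs no cast. Variables are de
   Bruijn indices: a quantifier binds entry 0 and shifts the others. *)
Definition definable_in n P : Prop :=
  depends_on n P /\ S [set v : 'rV[R]_n | P (env_of_row v)].

Lemma eq_definable_in n P Q :
  (forall e, P e <-> Q e) -> definable_in n P -> definable_in n Q.
Proof. by move=> PQ; suff -> : P = Q by []; apply/predeqP. Qed.

Lemma definable_in_set n (A : set 'rV[R]_n) : S A ->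
  definable_in n (fun e => A (\row_(i < n) e i)).
Proof.
move=> SA; split=> [e e' ee'|].
  suff -> : \row_(i < n) e i = \row_(i < n) e' i by [].
  by apply/rowP => i; rewrite !mxE ee'.
rewrite (_ : [set v : 'rV_n | _] = A) //.
by apply/seteqP; split=> v /=; rewrite row_env_of_row.
Qed.

Lemma definable_in_not n P : definable_in n P -> definable_in n (fun e => ~ P e).
Proof.
have [_ [setC_S _]] := omS; case=> depP SP; split; last exact: setC_S.
by move=> e e' /agree_sym/depP ee' nPe /ee'.
Qed.

Lemma definable_in_or n P Q : definable_in n P -> definable_in n Q ->
  definable_in n (fun e => P e \/ Q e).
Proof.
have [_ [_ [setU_S _]]] := omS.
move=> [depP SP] [depQ SQ]; split; last exact: setU_S.
by move=> e e' ee' [/(depP _ _ ee')|/(depQ _ _ ee')]; [left|right].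
Qed.

Lemma definable_inS n P : definable_in n P -> definable_in n.+1 P.
Proof.
have [_ [_ [_ [_ [cylinder_S _]]]]] := omS.
case=> depP /cylinder_S[SP _]; split=> [e e' /(agree_leq (leqnSn n))|].
  exact: depP.
rewrite -addn1 (_ : [set v | _] =
    [set v : 'rV_(n + 1) | P (env_of_row (lsubmx v))]) //.
by apply/seteqP; split=> v; apply: depP => i lt_in; rewrite env_of_lsubmx.
Qed.

Lemma definable_in_leq n m P : (n <= m)%N -> definable_in n P -> definable_in m P.
Proof.
by move/subnK <-; elim: (m - n)%N => // k IHk /IHk; exact: definable_inS.
Qed.

Lemma definable_in_tail n P :
  definable_in n P -> definable_in n.+1 (fun e => P (fun i => e i.+1)).
Proof.
have [_ [_ [_ [_ [cylinder_S _]]]]] := omS.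
case=> depP /cylinder_S[_ SP]; split=> [e e' ee'|].
  by apply: depP => i lt_in; exact: ee'.
rewrite -add1n (_ : [set v | _] =
    [set v : 'rV_(1 + n) | P (env_of_row (rsubmx v))]) //.
by apply/seteqP; split=> v; apply: depP => i lt_in; rewrite env_of_rsubmx.
Qed.

Lemma definable_in_ex_last n P : definable_in n.+1 P ->
  definable_in n (fun e => exists2 x, agree n e x & P x).
Proof.
have [_ [_ [_ [_ [_ [proj_S _]]]]]] := omS.
case=> depP; rewrite -[n.+1]addn1 => /proj_S SP; split=> [e e' ee' [x ex Px]|].
  by exists x => // i lt_in; rewrite -ee' ?ex.
rewrite (_ : [set v : 'rV_n | _] =
    @lsubmx R 1 n 1 @` [set w | P (env_of_row w)]) //.
apply/seteqP; split=> [v [x vx Px]|_ [w Pw <-]]; last first.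
  by exists (env_of_row w) => // i lt_in; rewrite env_of_lsubmx.
exists (row_mx v (\row__ x n)); last by rewrite row_mxKl.
apply: depP Px => i; rewrite ltnS leq_eqVlt => /predU1P[->|lt_in].
  have := @env_of_rsubmx n 1 (row_mx v (\row__ x n)) 0 isT.
  by rewrite row_mxKr addn0 => <-; rewrite (env_of_row_ord _ (@ord0 0)) mxE.
by rewrite -(@env_of_lsubmx n 1) // row_mxKl vx.
Qed.

Lemma definable_in_ex m k P : definable_in (m + k) P ->
  definable_in m (fun e => exists2 x, agree m e x & P x).
Proof.
elim: k P => [|k IHk] P.
  rewrite addn0 => dP; apply: eq_definable_in (dP) => e; split=> [Pe|[x ex Px]].
    by exists e.
  exact: dP.1 (agree_sym ex) Px.
rewrite addnS => /definable_in_ex_last/IHk; apply: eq_definable_in => e.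
split=> [[y ey [x yx Px]]|[x ex Px]]; last by exists x => //; exists x.
exists x => // i lt_im; rewrite ey //.
exact: (agree_leq (leq_addr k m) yx).
Qed.

Definition definable P : Prop := exists n, definable_in n P.

Lemma eq_definable P Q : (forall e, P e <-> Q e) -> definable P -> definable Q.
Proof. by move=> PQ [n dP]; exists n; exact: eq_definable_in dP. Qed.

Lemma definable_not P : definable P -> definable (fun e => ~ P e).
Proof. by move=> [n dP]; exists n; exact: definable_in_not. Qed.

Lemma definable_or P Q : definable P -> definable Q ->
  definable (fun e => P e \/ Q e).
Proof.
move=> [n dP] [m dQ]; exists (maxn n m); apply: definable_in_or.
- exact: definable_in_leq (leq_maxl _ _) dP.
- exact: definable_in_leq (leq_maxr _ _) dQ.
Qed.

Lemma definable_and P Q : definable P -> definable Q ->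
  definable (fun e => P e /\ Q e).
Proof.
move=> /definable_not dNP /definable_not dNQ.
have := definable_not (definable_or dNP dNQ); apply: eq_definable => e.
by split=> [/not_orP[/contrapT Pe /contrapT Qe]|[Pe Qe] []].
Qed.

Lemma definable_imp P Q : definable P -> definable Q ->
  definable (fun e => P e -> Q e).
Proof.
move=> dP dQ; apply: eq_definable (definable_or (definable_not dP) dQ) => e.
by split=> [[]|PQ] //; have [/PQ|] := EM (P e); [right|left].
Qed.

Lemma definable_cst (p : Prop) : definable (fun=> p).
Proof.
have [set0_S _] := omS.
have dF : definable (fun=> False) by exists 0%N; split=> //; exact: set0_S.
have [pT|pF] := EM p; last by apply: eq_definable dF => e; split.
by apply: eq_definable (definable_not dF) => e; split=> [|_ []].
Qed.

Lemma definable_all n (F : nat -> env -> Prop) : (forall i, definable (F i)) ->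
  definable (fun e => forall i, (i < n)%N -> F i e).
Proof.
move=> dF; elim: n => [|n /definable_and/(_ (dF n))].
  by apply: eq_definable (definable_cst True).
apply: eq_definable => e; split=> [[Fi Fn] i|Fi].
  by rewrite ltnS leq_eqVlt => /predU1P[->|/Fi].
by split=> [i lt_in|]; apply: Fi => //; exact: ltnW.
Qed.

Lemma definable_shift m P :
  definable P -> definable (fun e => P (fun i => e (m + i)%N)).
Proof.
elim: m => [//|m IHm] /IHm [n dP]; exists n.+1.
exact: definable_in_tail dP.
Qed.

(* The bound environment is stored beyond the [m] entries that [Q] reads. *)
Lemma definable_ex_env m (Q : env -> env -> Prop) :
  (forall x, depends_on m (Q^~ x)) ->
  definable (fun e => Q e (fun i => e (m + i)%N)) ->
  definable (fun e => exists x, Q e x).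
Proof.
move=> depQ [n /(definable_in_leq (leq_addl m n))/definable_in_ex dQ]; exists m.
apply: eq_definable_in dQ => e; split=> [[x ex Qx]|[x Qx]].
  by exists (fun i => x (m + i)%N); exact: depQ (agree_sym ex) Qx.
pose z i := if (i < m)%N then e i else x (i - m)%N.
have ez : agree m e z by move=> i; rewrite /z => ->.
exists z => //; rewrite (_ : (fun i => z (m + i)%N) = x); first exact: depQ ez Qx.
by apply/funext => i; rewrite /z ltnNge leq_addr addKn.
Qed.

Lemma definable_poly_eq n (p q : mpoly.mpoly n R) :
  definable (fun e => mpoly.meval (fun i : 'I_n => e i) p =
                      mpoly.meval (fun i : 'I_n => e i) q).
Proof.
have [_ [_ [_ [algebraic_S _]]]] := omS.
exists n; apply: eq_definable_in (definable_in_set (algebraic_S _ (p - q))) => e.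
rewrite /algebraic_set /= (@mpoly.meval_eq _ _ _ (fun i : 'I_n => e i)).
  by rewrite mpoly.mevalB; split=> [/subr0_eq|->] //; rewrite subrr.
by move=> i; rewrite mxE.
Qed.

Definition mpoly_var n (i : 'I_n) : mpoly.mpoly n R :=
  mpoly.mpolyX R (mpoly.mnm1 i).

Lemma definable_eq_var i j : definable (fun e => e i = e j).
Proof.
have lt_i : (i < (i + j).+1)%N by rewrite ltnS leq_addr.
have lt_j : (j < (i + j).+1)%N by rewrite ltnS leq_addl.
have := definable_poly_eq (mpoly_var (Ordinal lt_i)) (mpoly_var (Ordinal lt_j)).
by apply: eq_definable => e; rewrite !mpoly.mevalXU.
Qed.

Lemma definable_subst (s : nat -> nat) P :
  definable P -> definable (fun e => P (fun i => e (s i))).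
Proof.
move=> dP; have [n [depP _]] := dP; pose m := (\max_(i < n) s i).+1.
have s_lt_m i : (i < n)%N -> (s i < m)%N.
  by move=> lt_in; rewrite ltnS (leq_bigmax (Ordinal lt_in)).
have : definable (fun e => exists x, P x /\ agree n x (fun i => e (s i))).
  apply: (@definable_ex_env m) => [x e e' ee' [Px xe]|].
    by split=> // i lt_in; rewrite xe // ee' // s_lt_m.
  apply: definable_and; first exact: definable_shift.
  by apply: definable_all => i; exact: definable_eq_var.
apply: eq_definable => e; split=> [[x [Px /depP]]|Pe]; first exact.
by exists (fun i => e (s i)).
Qed.

Lemma definable_ex (Q : R -> env -> Prop) :
  definable (fun e => Q (e 0%N) (fun i => e i.+1)) ->
  definable (fun e => exists y, Q y e).
Proof.
move=> dQ; have [n [depQ _]] := dQ.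
have : definable (fun e => exists x, Q (x 0%N) e).
  apply: (@definable_ex_env n) => [x e e' ee'|].
    apply: (depQ (scons (x 0%N) e) (scons (x 0%N) e')).
    exact/(agree_leq (leqnSn n))/agree_scons.
  by rewrite addn0; exact: (definable_subst (scons n id) dQ).
by apply: eq_definable => e; split=> [[x]|[y]]; [exists (x 0%N)|exists (fun=> y)].
Qed.

Lemma definable_forall (Q : R -> env -> Prop) :
  definable (fun e => Q (e 0%N) (fun i => e i.+1)) ->
  definable (fun e => forall y, Q y e).
Proof.
move=> /definable_not/(definable_ex (Q := fun y e => ~ Q y e))/definable_not.
apply: eq_definable => e; split=> [/forallNP nQ y|Qe [y]]; last exact.
exact: contrapT (nQ y).
Qed.

Lemma definable_itv (I : interval R) : definable (fun e => e 0%N \in I).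
Proof.
have [_ [_ [_ [_ [_ [_ line_S]]]]]] := omS.
have SI : S [set v : 'rV_1 | v ord0 ord0 \in I].
  apply/line_S; exists [:: I]; apply/seteqP; split=> v /=.
    by exists I; rewrite ?mem_head.
  by case=> J /[!inE] /eqP->.
exists 1%N; apply: eq_definable_in (definable_in_set SI) => e /=.
by rewrite mxE.
Qed.

Lemma definable_finite_itv_union (P : R -> Prop) :
  definable (fun e => P (e 0%N)) -> finite_itv_union [set t | P t].
Proof.
have [_ [_ [_ [_ [_ [_ line_S]]]]]] := omS.
move=> [n /(definable_in_leq (leq_addl 1 n))/definable_in_ex[_ /line_S[s PE]]].
exists s; apply/predeqP => t; have := congr1 (@^~ (const_mx t)) PE.
rewrite /= mxE => <-.
have env0 : env_of_row (const_mx t : 'rV_1) 0 = t.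
  by rewrite (env_of_row_ord _ (@ord0 0)) mxE.
split=> [Pt|[x /(_ 0%N isT) <-]]; last by rewrite env0.
by exists (env_of_row (const_mx t : 'rV_1)); rewrite ?env0.
Qed.

Definition definable_term (t : env -> R) : Prop :=
  definable (fun e => e 0%N = t (fun i => e i.+1)).

Lemma definable_term_local t : definable_term t ->
  exists n, forall e e', agree n e e' -> t e = t e'.
Proof.
move=> [n [dep_t _]]; exists n => e e' ee'.
apply: (dep_t (scons (t e) e) (scons (t e) e')) => //.
exact/(agree_leq (leqnSn n))/agree_scons.
Qed.

Lemma definable_comp P (ts : nat -> env -> R) :
  definable P -> (forall i, definable_term (ts i)) ->
  definable (fun e => P (ts^~ e)).
Proof.
move=> dP dts; have [n [depP _]] := dP.
have [k ts_local] := choice (fun i => definable_term_local (dts i)).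
have : definable (fun e => exists x, P x /\ agree n x (ts^~ e)).
  apply: (@definable_ex_env (\max_(i < n) k i)) => [x e e' ee' [Px xts]|].
    split=> // i lt_in; rewrite xts //; apply: ts_local; apply: agree_leq ee'.
    exact: (leq_bigmax (Ordinal lt_in)).
  apply: definable_and; first exact: definable_shift.
  by apply: definable_all => i; exact: (definable_subst (scons _ id) (dts i)).
apply: eq_definable => e; split=> [[x [Px /depP]]|Pts]; first exact.
by exists (ts^~ e).
Qed.

Definition definable_rel (A : R -> R -> Prop) : Prop :=
  definable (fun e => A (e 0%N) (e 1%N)).

Lemma definable_rel_comp A t u :
  definable_rel A -> definable_term t -> definable_term u ->
  definable (fun e => A (t e) (u e)).
Proof.
move=> dA dt du.
by apply: (definable_comp (ts := scons t (fun=> u)) dA) => -[|i].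
Qed.

Lemma definable_eq t u : definable_term t -> definable_term u ->
  definable (fun e => t e = u e).
Proof. by apply: (@definable_rel_comp eq); exact: definable_eq_var. Qed.

Lemma definable_term_var i : definable_term (fun e => e i).
Proof. exact: definable_eq_var. Qed.

Lemma definable_term_subst (s : nat -> nat) t :
  definable_term t -> definable_term (fun e => t (fun i => e (s i))).
Proof. by move=> dt; exact: (definable_subst (scons 0%N (succn \o s)) dt). Qed.

Lemma definable_term_comp t (us : nat -> env -> R) :
  definable_term t -> (forall i, definable_term (us i)) ->
  definable_term (fun e => t (us^~ e)).
Proof.
move=> dt dus.
pose ts := scons (fun e => e 0%N) (fun i e => us i (fun j => e j.+1)).
apply: (definable_comp (ts := ts) dt) => -[|i]; first exact: definable_term_var.
exact: (definable_term_subst succn (dus i)).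
Qed.

Lemma definable_term_poly n (p : mpoly.mpoly n R) :
  definable_term (fun e => mpoly.meval (fun i : 'I_n => e i) p).
Proof.
pose q := mpoly.comp_mpoly [tuple mpoly_var (lift ord0 i) | i < n] p.
apply: eq_definable (definable_poly_eq (mpoly_var (@ord0 n)) q) => e.
rewrite mpoly.mevalXU mpoly.comp_mpoly_meval.
rewrite (@mpoly.meval_eq _ _ _ (fun i : 'I_n => e i.+1)) // => i.
by rewrite tnth_mktuple mpoly.mevalXU.
Qed.

Lemma definable_term_cst c : definable_term (fun=> c).
Proof.
have := definable_term_poly (mpoly.mpolyC 0 c).
by apply: eq_definable => e; rewrite mpoly.mevalC.
Qed.

Lemma definable_term_add : definable_term (fun e => e 0%N + e 1%N).
Proof.
have := definable_term_poly (mpoly_var (@ord0 1) + mpoly_var (@ord_max 1)).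
by apply: eq_definable => e; rewrite mpoly.mevalD !mpoly.mevalXU.
Qed.

Lemma definable_term_mul : definable_term (fun e => e 0%N * e 1%N).
Proof.
have := definable_term_poly (mpoly_var (@ord0 1) * mpoly_var (@ord_max 1)).
by apply: eq_definable => e; rewrite mpoly.mevalM !mpoly.mevalXU.
Qed.

Lemma definable_term_op2 (op : R -> R -> R) t u :
  definable_term (fun e => op (e 0%N) (e 1%N)) ->
  definable_term t -> definable_term u ->
  definable_term (fun e => op (t e) (u e)).
Proof.
move=> dop dt du.
by apply: (definable_term_comp (us := scons t (fun=> u)) dop) => -[|i].
Qed.

Lemma definable_termD t u : definable_term t -> definable_term u ->
  definable_term (fun e => t e + u e).
Proof. exact: definable_term_op2 definable_term_add. Qed.

Lemma definable_termM t u : definable_term t -> definable_term u ->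
  definable_term (fun e => t e * u e).
Proof. exact: definable_term_op2 definable_term_mul. Qed.

Lemma definable_termN t : definable_term t -> definable_term (fun e => - t e).
Proof.
move=> dt; rewrite (_ : (fun e => _) = (fun e => -1 * t e)).
  exact: definable_termM (definable_term_cst _) dt.
by apply/funext => e; rewrite mulN1r.
Qed.

Lemma definable_le t u : definable_term t -> definable_term u ->
  definable (fun e => t e <= u e).
Proof.
apply: (@definable_rel_comp (fun y z => y <= z)).
have : definable (fun e => exists z, e 1%N = e 0%N + z * z).
  apply: definable_ex; apply: definable_eq; first exact: definable_term_var.
  apply: definable_termD; first exact: definable_term_var.
  by apply: definable_termM; exact: definable_term_var.
apply: eq_definable => e; split=> [[z ->]|le01].
  by rewrite lerDl -expr2 sqr_ge0.
exists (Num.sqrt (e 1%N - e 0%N)).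
by rewrite -expr2 sqr_sqrtr ?subr_ge0 // subrKC.
Qed.

Lemma definable_lt t u : definable_term t -> definable_term u ->
  definable (fun e => t e < u e).
Proof.
move=> dt du; apply: eq_definable (definable_not (definable_le du dt)) => e.
by rewrite ltNge; split=> /negP.
Qed.

Lemma definable_mem_itv t (I : interval R) :
  definable_term t -> definable (fun e => t e \in I).
Proof.
by move=> dt; exact: (definable_comp (ts := fun=> t) (definable_itv I)).
Qed.

Lemma definable_row_mx n m (A : set 'rV[R]_(n + m))
    (ts us : nat -> env -> R) :
  S A -> (forall i, definable_term (ts i)) -> (forall i, definable_term (us i)) ->
  definable (fun e => A (row_mx (\row_(i < n) ts i e) (\row_(j < m) us j e))).
Proof.
move=> SA dts dus; pose vs i := if (i < n)%N then ts i else us (i - n)%N.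
have dA : definable (fun e => A (\row_i e i)).
  by exists (n + m)%N; exact: definable_in_set.
have dvs i : definable_term (vs i) by rewrite /vs; case: ifP.
apply: eq_definable (definable_comp dA dvs) => e.
rewrite (_ : row_mx _ _ = \row_i vs i e) //; apply/rowP => i; rewrite !mxE /vs.
by case: split_ordP => j ->; rewrite mxE //= addKn.
Qed.

Lemma definable_setmap_row p (D : 'rV[R]_p -> set 'rV[R]_p)
    (ts us : nat -> env -> R) :
  definable_setmap S D ->
  (forall i, definable_term (ts i)) -> (forall i, definable_term (us i)) ->
  definable (fun e => D (\row_(i < p) ts i e) (\row_(i < p) us i e)).
Proof.
move=> dD dts dus; apply: eq_definable (definable_row_mx dD dts dus) => e.
by rewrite /= row_mxKl row_mxKr.
Qed.

Lemma definable_fun_row p (f : 'rV[R]_p -> R) (ts : nat -> env -> R) t :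
  definable_fun S f -> (forall i, definable_term (ts i)) -> definable_term t ->
  definable (fun e => f (\row_(i < p) ts i e) = t e).
Proof.
move=> df dts dt.
apply: eq_definable (definable_row_mx (us := fun=> t) df dts _) => // e.
by rewrite /= row_mxKl row_mxKr mxE.
Qed.

Definition definable_map (h : R -> R) : Prop :=
  definable_term (fun e => h (e 0%N)).

Lemma definable_map_comp h t :
  definable_map h -> definable_term t -> definable_term (fun e => h (t e)).
Proof. by move=> dh dt; exact: (definable_term_comp (us := fun=> t) dh). Qed.

Lemma definable_xget (B : R -> set R) :
  definable_rel B -> (forall r, is_subset1 (B r)) ->
  definable_map (fun r => xget 0 (B r)).
Proof.
move=> dB uniqB.
have dB' : definable (fun e => B (e 1%N) (e 0%N)).
  by apply: definable_rel_comp dB _ _; exact: definable_term_var.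
have dB0 : definable (fun e => ~ (exists y, B (e 1%N) y) /\ e 0%N = 0).
  apply: definable_and.
    apply/definable_not/definable_ex.
    by apply: definable_rel_comp dB _ _; exact: definable_term_var.
  exact: definable_eq (definable_term_var _) (definable_term_cst _).
apply: eq_definable (definable_or dB' dB0) => e; split=> [[Be|[noB ->]]|->].
- by rewrite (xget_subset1 0 Be).
- by rewrite xgetPN // => y By; apply: noB; exists y.
- by case: xgetP => [y _ By|noB]; [left|right; split=> // -[y /noB]].
Qed.

Ltac definability_step :=
  lazymatch goal with
  | |- definable (fun e => forall y : Real.sort _, _) => apply: definable_forall
  | |- definable (fun e => exists y : Real.sort _, _) => apply: definable_ex
  | |- definable (fun e => _ /\ _) => apply: definable_and
  | |- definable (fun e => ~ _) => apply: definable_not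
  | |- definable (fun e => is_true (_ < _)) => apply: definable_lt
  | |- definable (fun e => is_true (_ <= _)) => apply: definable_le
  | |- definable (fun e => is_true (_ \in _)) => apply: definable_mem_itv
  | |- definable (fun e => _ = _) => apply: definable_eq
  | |- definable (fun e => _ -> _) => apply: definable_imp
  | dA : definable_rel ?A |- definable (fun e => ?A _ _) =>
      refine (definable_rel_comp dA _ _)
  | |- definable_term (fun e => _ + _) => apply: definable_termD
  | |- definable_term (fun e => _ * _) => apply: definable_termM
  | |- definable_term (fun e => - _) => apply: definable_termN
  | dh : definable_map ?h |- definable_term (fun e => ?h _) =>
      refine (definable_map_comp dh _)
  | dh : forall i, definable_map (?h i) |- definable_term (fun e => ?h _ _) =>
      refine (definable_map_comp (dh _) _)
  | |- definable_term (fun e => e _) => exact: definable_term_var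
  | |- definable_term (fun=> _) => exact: definable_term_cst
  end; cbv beta.

Ltac definability :=
  cbv beta delta [definable_rel definable_map]; repeat definability_step.

(** * Definable choice and Lipschitz reparametrization *)

Implicit Types (I J : interval R) (r : R).

Lemma definable_choice I (A : R -> R -> Prop) :
  proper_itv I -> definable_rel A -> {in I, forall r, exists y, A r y} ->
  exists2 J, proper_subitv J I &
    exists2 h, definable_map h & {in J, forall r, A r (h r)}.
Proof.
move=> properI dA exA; pose least r y := A r y /\ forall z, A r z -> y <= z.
have dleast : definable_rel least by rewrite /least; definability.
have least1 r : is_subset1 (least r).
  by move=> y z [Ay miny] [Az minz]; apply/le_anti; rewrite miny ?minz.
pose X (o : option rat) : set R :=
  if o is Some q then [set r | A r (ratr q)] else [set r | exists y, least r y].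
have uX o : finite_itv_union (X o).
  by case: o => [q|]; apply: definable_finite_itv_union; definability.
have [|J subJ [[q|] JX]] := countable_cover_interior properI uX.
- move=> r /exA A0; have uA : finite_itv_union [set y | A r y].
    by apply: definable_finite_itv_union; definability.
  have [[q Aq]|[y Ay ymin]] := finite_itv_union_rat_or_min uA A0.
    by exists (Some q).
  by exists None, y.
- exists J => //; exists (fun=> ratr q) => [|r /JX//]; definability.
exists J => //; exists (fun r => xget 0 (least r)); first exact: definable_xget.
by move=> r /JX/(xgetPex 0)[].
Qed.

Lemma definable_curve_choice I (Z : R -> env -> Prop) :
  proper_itv I -> definable (fun e => Z (e 0%N) (fun i => e i.+1)) ->
  {in I, forall r, exists x, Z r x} ->
  exists2 J, proper_subitv J I &
    exists2 h : nat -> R -> R, (forall i, definable_map (h i)) &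
      {in J, forall r, Z r (h^~ r)}.
Proof.
move=> properI dZ exZ; have [n [depZ _]] := dZ.
suff [J subJ [h dh Zh]] : exists2 J, proper_subitv J I &
    exists2 h : nat -> R -> R, (forall i, definable_map (h i)) &
      {in J, forall r, exists2 x, agree n x (h^~ r) & Z r x}.
  exists J => //; exists h => // r /Zh[x xh].
  apply: (depZ (scons r x) (scons r (h^~ r))).
  exact/(agree_leq (leqnSn n))/agree_scons.
elim: n {depZ} => [|m [J subJ [h dh Zh]]].
  exists I; first by split.
  exists (fun _ _ => 0) => [i|r /exZ[x Zx]]; first by definability.
  by exists x.
pose A r y := exists x, [/\ agree m x (h^~ r), Z r x & x m = y].
have dA : definable_rel A.
  pose Q e x := [/\ agree m x (h^~ (e 0%N)), Z (e 0%N) x & x m = e 1%N].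
  apply: (@definable_ex_env 2 Q) => [x e e' ee'|].
    by rewrite /Q (ee' 0%N) ?(ee' 1%N).
  have dZ2 := definable_subst (scons 0%N (addn 2)) dZ.
  have dh2 : definable (fun e => forall i, (i < m)%N -> e i.+2 = h i (e 0%N)).
    by apply: definable_all => i; definability.
  have dm : definable (fun e => e m.+2 = e 1%N) by definability.
  apply: eq_definable (definable_and dh2 (definable_and dZ2 dm)) => e.
  by split=> [[? []]|[? ? ?]].
have [|K subK [k dk Ak]] := definable_choice subJ.2 dA.
  by move=> r /Zh[x xh Zx]; exists (x m), x.
exists K; first exact: proper_subitv_trans subJ subK.
exists (fun i => if i == m then k else h i) => [i|r /Ak[x [xh Zx xm]]].
  by case: eqP.
exists x => // i; rewrite ltnS leq_eqVlt; case: eqP => [->//|_] /=; exact: xh.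
Qed.

Lemma definable_map_monotone I h : proper_itv I -> definable_map h ->
  exists2 J, proper_subitv J I &
    {in J &, {homo h : x y / x <= y}} \/ {in J &, {homo (\- h) : x y / x <= y}}.
Proof.
move=> properI dh.
pose X (i : nat * bool) : set R :=
  [set r | forall z : R, r < z -> z < r + i.1.+1%:R^-1 ->
    if i.2 then h r <= h z else h z <= h r].
have uX i : finite_itv_union (X i).
  by case: i => n []; rewrite /X /=;
    apply: definable_finite_itv_union; definability.
have [|J subJ [[n s] JX]] := countable_cover_interior properI uX.
  move=> r _; have := @finite_itv_union_right_germ _ [set z | h r <= h z] r.
  case; first by apply: definable_finite_itv_union; definability.
    by move=> /at_right_natSinv[n ge_h]; exists (n, true).
  move=> /at_right_natSinv[n lt_h]; exists (n, false) => z rz zn.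
  by have /negP := lt_h z rz zn; rewrite -ltNge => /ltW.
have n0 : 0 < n.+1%:R^-1 :> R by rewrite invr_gt0.
have [K subK short] := proper_subitv_short subJ.2 n0.
exists K; first exact: proper_subitv_trans subJ subK.
have KX x y : x \in K -> y \in K -> x < y -> if s then h x <= h y else h y <= h x.
  by move=> xK yK xy; apply: (JX x) => //; [exact: subK.1|exact: short].
by case: s {JX} KX => KX; [left|right] => x y xK yK;
  rewrite le_eqVlt => /predU1P[->//|/(KX x y xK yK)]; rewrite ?lerN2.
Qed.

Definition controls J (l h : R -> R) : Prop :=
  {in J &, forall r s, r <= s -> `|h s - h r| <= l s - l r}.

Lemma controls_dist J l h :
  controls J l h -> {in J &, forall r s, `|h s - h r| <= `|l s - l r|}.
Proof.
move=> lh r s rJ sJ; wlog rs : r s rJ sJ / r <= s => [th|].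
  by have [/th|/ltW/th] := leP r s; [exact|rewrite distrC [leRHS]distrC; exact].
exact: le_trans (lh _ _ rJ sJ rs) (ler_norm _).
Qed.

Lemma controlsD J K l h k : {subset K <= J} -> controls J l h ->
  {in K &, {homo k : x y / x <= y}} -> controls K (fun r => l r + k r) h.
Proof.
move=> KJ lh ndk r s rK sK rs; rewrite opprD addrACA.
by rewrite ler_wpDr ?subr_ge0 ?ndk // lh ?KJ.
Qed.

Lemma definable_arc_length n (h : nat -> R -> R) I :
  proper_itv I -> (forall i, definable_map (h i)) ->
  exists2 J, proper_subitv J I &
    exists l, [/\ definable_map l, controls J l id &
      forall i, (i < n)%N -> controls J l (h i)].
Proof.
move=> properI dh; elim: n => [|n [J subJ [l [dl lid lh]]]].
  exists I; first by split.
  exists id; split=> //; first by definability.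
  by move=> r s _ _ rs; rewrite ger0_norm ?subr_ge0.
have [K subK mono] := definable_map_monotone subJ.2 (dh n).
have [k [dk ndk kE]] : exists k, [/\ definable_map k,
    {in K &, {homo k : x y / x <= y}} &
    forall r s, `|k s - k r| = `|h n s - h n r|].
  case: mono => mono; first by exists (h n).
  exists (\- h n); split=> // [|r s]; first exact: definable_termN (dh n).
  by rewrite /= -opprD normrN.
exists K; first exact: proper_subitv_trans subJ subK.
exists (fun r => l r + k r); split; first by definability.
  exact: controlsD subK.1 lid ndk.
move=> i; rewrite ltnS leq_eqVlt => /predU1P[->|/lh lhi]; last first.
  exact: controlsD subK.1 lhi ndk.
move=> r s rK sK rs; rewrite -kE ger0_norm ?subr_ge0 ?ndk // opprD addrACA.
by rewrite lerDr (le_trans (normr_ge0 _) (lid _ _ _ _ rs)) // subK.1.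
Qed.

Lemma definable_image_interior J l :
  proper_itv J -> definable_map l -> {in J &, injective l} ->
  exists2 K, proper_itv K & [set` K] `<=` l @` [set` J].
Proof.
move=> properJ dl l_inj; apply: finite_itv_union_interior.
  have : finite_itv_union [set s | exists r, r \in J /\ l r = s].
    by apply: definable_finite_itv_union; definability.
  by congr finite_itv_union; apply/predeqP => s; split=> [[r []]|[r]]; exists r.
have /inj_card_eq/eq_finite_set -> : {in [set` J] &, injective l}.
  by move=> r s /set_mem rJ /set_mem sJ; exact: l_inj.
by move=> /finite_set_countable; exact: proper_itv_uncountable.
Qed.

Lemma definable_lipschitz_reparametrization n (h : nat -> R -> R) I :
  proper_itv I -> (forall i, definable_map (h i)) ->
  exists (phi : R -> R) (L : R),
    [/\ 0 <= L, phi 0 != phi 1, {in `[0, 1], forall r, phi r \in I} &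
    forall i, (i < n)%N -> L.-lipschitz_`[0, 1] (h i \o phi)].
Proof.
move=> properI dh.
have [J [JI properJ] [l [dl lid lh]]] := definable_arc_length n properI dh.
have [|K [c [d [cK dK cd]]] KlJ] := definable_image_interior properJ dl.
  move=> r s rJ sJ lrs; apply/eqP; rewrite -subr_eq0 -normr_le0.
  by rewrite (le_trans (controls_dist lid sJ rJ)) // lrs subrr normr0.
have /choice[phi phiE] : forall r, exists s, r \in `[0, 1] ->
    s \in J /\ l s = c + r * (d - c).
  move=> r; have [r01|] := boolP (r \in `[0, 1]); last by exists 0.
  have [|s sJ ls] := KlJ (c + r * (d - c)); last by exists s.
  apply: (@interval_is_interval _ K _ _ cK dK).
  by move: r01; rewrite in_itv /=; nra.
exists phi, (d - c); split; first by rewrite subr_ge0 ltW.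
- have [_ l0] : phi 0 \in J /\ l (phi 0) = c + 0 * (d - c).
    by apply: phiE; rewrite in_itv /= lexx ler01.
  have [_ l1] : phi 1 \in J /\ l (phi 1) = c + 1 * (d - c).
    by apply: phiE; rewrite in_itv /= lexx ler01.
  by apply/eqP => phi01; move: l1; rewrite -phi01 l0; lra.
- by move=> r /phiE[/JI].
move=> i lt_in [r s] /= [/phiE[rJ lr] /phiE[sJ ls]].
rewrite (le_trans (controls_dist (lh i lt_in) sJ rJ)) // lr ls.
by rewrite opprD addrACA subrr add0r -mulrBl normrM mulrC gtr0_norm ?subr_gt0.
Qed.

End definability.

(** * Conservative fields along critical curves *)

Section absolutely_continuous_curves.
Variables (R : realType) (p : nat).
Implicit Types g h : R -> 'rV[R]_p.

Lemma row_lipschitz (L : R) (A : set R) (h : 'I_p -> R -> R) : 0 <= L ->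
  (forall i, L.-lipschitz_A (h i)) -> L.-lipschitz_A (fun t => \row_i h i t).
Proof.
move=> L0 lip [s t] Ast /=; rewrite [leLHS]/Num.norm /= mx_normrE.
apply: bigmax_le => [|[i j] _]; first by rewrite mulr_ge0.
by rewrite !mxE; exact: lip Ast.
Qed.

Lemma lipschitz_abs_continuous01 L g :
  L.-lipschitz_`[0, 1] g -> abs_continuous01 g.
Proof.
move=> lip e e0; have L0 : 0 < `|L| + 1 by rewrite ltr_wpDl.
exists (e / (`|L| + 1)); first by rewrite divr_gt0.
move=> k a b ab _; rewrite ltr_pdivlMr // mulrC => /(le_lt_trans _); apply.
rewrite mulr_sumr; apply: ler_sum => i _; have [ai [aib bi]] := ab i.
have /lip : (`[0, 1] `*` `[0, 1])%classic (b i, a i).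
  by split; rewrite /= in_itv /=; lra.
move=> /le_trans; apply; rewrite /= ger0_norm ?subr_ge0 //.
by rewrite ler_wpM2r ?subr_ge0 // (le_trans (ler_norm L)) // lerDl.
Qed.

Lemma abs_continuous01D g h :
  abs_continuous01 g -> abs_continuous01 h ->
  abs_continuous01 (fun t => g t + h t).
Proof.
move=> ACg ACh e e0; have e20 : 0 < e / 2 by rewrite divr_gt0.
have [d d0 gd] := ACg _ e20; have [d' d'0 hd'] := ACh _ e20.
exists (Num.min d d'); first by rewrite lt_min d0.
move=> k a b ab disj; rewrite lt_min.
move=> /andP[/(gd _ _ _ ab disj) g_lt /(hd' _ _ _ ab disj) h_lt].
rewrite [ltRHS]splitr; apply: le_lt_trans (ltrD g_lt h_lt); rewrite -big_split /=.
by apply: ler_sum => i _; rewrite opprD addrACA ler_normD.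
Qed.

Lemma abs_continuous01_comp (M : R) (phi : R -> R) g :
  0 < M -> (forall t, 0 <= phi t <= 1) ->
  (forall s t, s <= t -> 0 <= phi t - phi s <= M * (t - s)) ->
  abs_continuous01 g -> abs_continuous01 (g \o phi).
Proof.
move=> M0 phi01 phi_incr ACg e e0; have [d d0 gd] := ACg e e0.
have phi_le s t : s <= t -> phi s <= phi t.
  by move=> /phi_incr/andP[]; rewrite subr_ge0.
exists (d / M); first by rewrite divr_gt0.
move=> k a b ab disj; rewrite ltr_pdivlMr // mulrC mulr_sumr => sum_lt.
apply: (gd k (phi \o a) (phi \o b)).
- move=> i /=; have [_ [aib _]] := ab i.
  have /andP[? _] := phi01 (a i); have /andP[_ ?] := phi01 (b i).
  by split=> //; split=> //; exact: phi_le.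
- by move=> i j /disj[] /phi_le; [left|right].
apply: le_lt_trans sum_lt; apply: ler_sum => i _; have [_ [aib _]] := ab i.
by have /andP[] := phi_incr _ _ aib.
Qed.

Lemma abs_continuous01_rev g :
  abs_continuous01 g -> abs_continuous01 (fun t => g (1 - t)).
Proof.
move=> ACg e e0; have [d d0 gd] := ACg e e0; exists d => // k a b ab disj sum_lt.
under eq_bigr do rewrite distrC.
apply: (gd k (fun i => 1 - b i) (fun i => 1 - a i)).
- by move=> i; have [? [? ?]] := ab i; lra.
- by move=> i j /disj[?|?]; [right|left]; lra.
by under eq_bigr do rewrite opprB addrC addrA addrNK.
Qed.

Definition clamp01 (t : R) : R := Num.max 0 (Num.min 1 t).

Lemma clamp01_itv t : 0 <= clamp01 t <= 1.
Proof. by rewrite /clamp01 le_max lexx /= ge_max ler01 ge_min lexx. Qed.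

Lemma clamp01_le0 t : t <= 0 -> clamp01 t = 0.
Proof. by move=> t0; rewrite /clamp01 (min_idPr _) ?(max_idPl _) //; lra. Qed.

Lemma clamp01_ge1 t : 1 <= t -> clamp01 t = 1.
Proof. by move=> t1; rewrite /clamp01 (min_idPl t1) (max_idPr _). Qed.

Lemma clamp01_incr s t : s <= t -> 0 <= clamp01 t - clamp01 s <= t - s.
Proof.
move=> st; rewrite /clamp01.
case: (leP 1 t); case: (leP 1 s); rewrite ?(max_idPr ler01) => ? ?;
  try case: (leP 0 s) => ?; try case: (leP 0 t) => ?; lra.
Qed.

(* The curve runs along a segment from [0] to [g 0], rests there for
   [1/3 <= t <= 2/3], and then follows [g]: thanks to the rest, around each [t] it
   agrees with its first half or with its second half. *)
Definition from_origin g (t : R) : 'rV[R]_p :=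
  (clamp01 (3 * t) - 1) *: g 0 + g (clamp01 (3 * t - 2)).

Lemma from_origin_before g t :
  t <= 2 / 3 -> from_origin g t = clamp01 (3 * t) *: g 0.
Proof.
move=> t23; rewrite /from_origin (clamp01_le0 (t := 3 * t - 2)); last lra.
by rewrite scalerBl scale1r subrK.
Qed.

Lemma from_origin_after g t :
  1 / 3 <= t -> from_origin g t = g (clamp01 (3 * t - 2)).
Proof.
move=> t13; rewrite /from_origin (clamp01_ge1 (t := 3 * t)); last lra.
by rewrite subrr scale0r add0r.
Qed.

Lemma from_origin0 g : from_origin g 0 = 0.
Proof. by rewrite from_origin_before ?clamp01_le0 ?scale0r //; lra. Qed.

Lemma from_origin1 g : from_origin g 1 = g 1.
Proof. by rewrite from_origin_after ?clamp01_ge1 //; lra. Qed.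

Lemma from_origin_abs_continuous01 g :
  abs_continuous01 g -> abs_continuous01 (from_origin g).
Proof.
have clamp_comp c (k : R -> 'rV[R]_p) :
    abs_continuous01 k -> abs_continuous01 (fun t => k (clamp01 (3 * t + c))).
  apply: (@abs_continuous01_comp 3 (fun t => clamp01 (3 * t + c))) => //.
    by move=> t; exact: clamp01_itv.
  move=> s t st; have st3 : 3 * s + c <= 3 * t + c by lra.
  by have := clamp01_incr st3; lra.
move=> ACg; apply: abs_continuous01D; last exact: clamp_comp.
under eq_fun do rewrite -[3 * _]addr0.
apply: (clamp_comp 0 (fun t => (t - 1) *: g 0)).
apply: (@lipschitz_abs_continuous01 `|g 0|) => -[s t] _ /=.
by rewrite -scalerBl normrZ mulrC opprB addrA subrK.
Qed.

End absolutely_continuous_curves.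

(* Monotonicity for arbitrary functions: the integral is the difference of two
   suprema over simple functions, so no measurability is involved. *)
Lemma le_integral_pointwise (d : measure_display) (T : measurableType d)
    (R : realType) (mu : {measure set T -> \bar R}) (A : set T)
    (f g : T -> \bar R) :
  (forall x, A x -> (f x <= g x)%E) ->
  (\int[mu]_(x in A) f x <= \int[mu]_(x in A) g x)%E.
Proof.
move=> fg; have fgA x : ((f \_ A) x <= (g \_ A) x)%E.
  by rewrite /patch; case: ifPn => // /set_mem/fg.
rewrite /integral; apply: leeB; apply: ereal_sup_le => _ [h hf <-];
  exists h => // x; apply: le_trans (hf x) _.
- by rewrite !funeposE ge_max !le_max fgA lexx orbT.
- by rewrite !funenegE ge_max !le_max leeN2 fgA lexx orbT.
Qed.

Section conservative_fields.
Variables (R : realType) (p : nat) (D : 'rV[R]_p -> set 'rV[R]_p).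
Implicit Types g h : R -> 'rV[R]_p.

Lemma near_eq_support_integrand g h t :
  (\near t, g t = h t) -> support_integrand D g t = support_integrand D h t.
Proof.
move=> gh; rewrite /support_integrand (nbhs_singleton gh).
by rewrite !derive1E (near_eq_derive _ gh).
Qed.

Lemma support_integrand_ge0 g t : D (g t) 0 -> (0 <= support_integrand D g t)%E.
Proof.
move=> D0; apply: ereal_sup_ubound; exists 0 => //.
by congr EFin; rewrite /dotp big1 // => i _; rewrite mxE mulr0.
Qed.

Lemma support_integrand_cst_le0 (x : 'rV[R]_p) t :
  (support_integrand D (cst x) t <= 0)%E.
Proof.
apply: ge_ereal_sup => _ [v _ <-]; rewrite derive1_cst lee_fin /dotp.
by rewrite big1 // => i _; rewrite mxE mul0r.
Qed.

Variable f : 'rV[R]_p -> R.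
Hypothesis consD : conservative_field_for D f.

Lemma conservative_from_origin g : abs_continuous01 g ->
  (f (g 1))%:E = ((f 0)%:E + path_integral D (from_origin g))%E.
Proof.
move=> /from_origin_abs_continuous01 ACg.
exact: consD.2 _ _ ACg (from_origin0 g) (from_origin1 g).
Qed.

Lemma conservative_critical_le g : abs_continuous01 g ->
  {in `[0, 1], forall t, D (g t) 0} -> f (g 0) <= f (g 1).
Proof.
move=> ACg crit; pose rest : R -> 'rV[R]_p := cst (g 0).
have AC_rest : abs_continuous01 rest.
  apply: (@lipschitz_abs_continuous01 _ _ 0) => st _ /=.
  by rewrite subrr normr0 mul0r.
rewrite -lee_fin (conservative_from_origin ACg).
rewrite (conservative_from_origin AC_rest).
apply/leeD2l/le_integral_pointwise => t _; have [t23|t23] := ltP t (2 / 3).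
  rewrite (@near_eq_support_integrand _ (from_origin g)) //; near=> s.
  rewrite !from_origin_before // ltW //; near: s; exact: lt_nbhsl.
apply: (@le_trans _ _ 0%E).
  rewrite (@near_eq_support_integrand _ rest) ?support_integrand_cst_le0 //.
  near=> s; rewrite from_origin_after // ltW //; near: s; apply: lt_nbhsr; lra.
apply: support_integrand_ge0; rewrite from_origin_after; last lra.
by apply: crit; rewrite in_itv clamp01_itv.
Unshelve. all: by end_near. Qed.

Lemma conservative_critical_cst g : abs_continuous01 g ->
  {in `[0, 1], forall t, D (g t) 0} -> f (g 0) = f (g 1).
Proof.
move=> ACg crit; apply/le_anti; rewrite conservative_critical_le //=.
have := conservative_critical_le (abs_continuous01_rev ACg); rewrite subr0 subrr.
by apply=> t; rewrite in_itv /= => t01; apply: crit; rewrite in_itv /=; lra.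
Qed.

End conservative_fields.

Section critical_values.
Variables (R : realType) (S : forall n : nat, set (set 'rV[R]_n)).
Variables (p : nat) (D : 'rV[R]_p -> set 'rV[R]_p) (f : 'rV[R]_p -> R).
Hypothesis omS : o_minimal S.
Hypotheses (deff : definable_fun S f) (defD : definable_setmap S D).

Definition critical_at (r : R) (x : nat -> R) : Prop :=
  f (\row_(i < p) x i) = r /\ D (\row_(i < p) x i) 0.

Lemma definable_critical_at :
  definable S (fun e => critical_at (e 0%N) (fun i => e i.+1)).
Proof.
have dvar i : definable_term S (fun e => e i) := definable_term_var omS i.
apply: definable_and => //.
  by apply: (@definable_fun_row _ _ omS p f (fun i e => e i.+1) (fun e => e 0%N)).
have := definable_setmap_row omS defD (fun i => dvar i.+1)
  (fun=> definable_term_cst omS 0).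
apply: eq_definable => e; rewrite (_ : \row_(i < p) 0 = 0) //.
by apply/rowP => i; rewrite !mxE.
Qed.

Lemma critical_valueP r :
  [set f x | x in [set x | D x 0]] r <-> exists x, critical_at r x.
Proof.
split=> [[x Dx <-]|[x [fx Dx]]]; last by exists (\row_(i < p) x i).
by exists (env_of_row x); rewrite /critical_at row_env_of_row.
Qed.

Lemma critical_values_finite_itv_union :
  finite_itv_union [set f x | x in [set x | D x 0]].
Proof.
rewrite (_ : [set _ | _ in _] = [set r | exists x, critical_at r x]); last first.
  by apply/predeqP => r; exact: critical_valueP.
apply: (definable_finite_itv_union omS).
apply: (@definable_ex_env _ _ omS 1 (fun e => critical_at (e 0%N))) => //.
  by move=> x e e' /(_ 0%N isT) ->.
exact: definable_critical_at.
Qed.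

End critical_values.

Theorem theorem5 (R : realType) (S : forall n : nat, set (set 'rV[R]_n))
    (p : nat) (D : 'rV[R]_p -> set 'rV[R]_p) (f : 'rV[R]_p -> R) :
  o_minimal S ->
  conservative_field_for D f ->
  definable_fun S f ->
  definable_setmap S D ->
  finite_set [set f x | x in [set x | D x 0]].
Proof.
move=> omS consD deff defD; apply: contrapT.
have uV := critical_values_finite_itv_union omS deff defD.
move=> /(finite_itv_union_interior uV)[I properI I_critical].
have [|J [_ properJ] [h dh h_critical]] :=
    definable_curve_choice omS properI (definable_critical_at omS deff defD).
  by move=> r /I_critical/critical_valueP.
have [phi [L [L0 phi01 phiJ phi_lip]]] :=
  definable_lipschitz_reparametrization omS p properJ dh.
pose g t : 'rV[R]_p := \row_i h i (phi t).
have ACg : abs_continuous01 g.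
  by apply/lipschitz_abs_continuous01/(row_lipschitz L0) => i; exact: phi_lip.
have g_critical t : t \in `[0, 1] -> f (g t) = phi t /\ D (g t) 0.
  by move=> /phiJ/h_critical.
have := conservative_critical_cst consD ACg (fun t t01 => (g_critical t t01).2).
rewrite (g_critical 0 _).1 ?(g_critical 1 _).1 ?in_itv /= ?lexx ?ler01 //.
by move/eqP; apply/negP.
Qed.
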